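(* Consider the bilinear system $\mathbf{x}(t+1)=\mathbf{A}\mathbf{x}(t)+\mathbf{B}\mathbf{u}(t)+\mathbf{N}(\mathbf{x}(t)\otimes\mathbf{u}(t))$ with $\mathbf{x}(t)\in\mathbb{R}^n$, $\mathbf{u}(t)\in\mathbb{R}^m$, $\mathbf{A}\in\mathbb{R}^{n\times n}$, $\mathbf{B}\in\mathbb{R}^{n\times m}$, $\mathbf{N}\in\mathbb{R}^{n\times mn}$, and assume the pair $(\mathbf{A},[\mathbf{B}\ \mathbf{N}])$ is controllable. Let $L\ge T\ge 1$ be integers, and let $\mathbf{x}(0),\dots,\mathbf{x}(L)$ be a state sequence generated by the system with input sequence $\mathbf{u}(0),\dots,\mathbf{u}(L-1)$. Assume these data are $T$-persistently exciting, i.e. the matrix $\mathcal{G}_T(L)$ (defined in the context) has full row rank. Then: (i) For any input/state trajectory $(\bar{\mathbf{u}}_{[0,T-1]},\bar{\mathbf{x}}_{[0,T]})$ of the system there exists $\alpha\in\mathbb{R}^{L-T+1}$ such that $$\begin{bmatrix}\bar{\mathbf{x}}_{[0,T]}\\ \bar{\mathbf{u}}_{[0,T-1]}\end{bmatrix}=\begin{bmatrix}\mathcal{H}_{T+1}(\mathbf{x}_{[0,L]})\\ \mathcal{H}_T(\mathbf{u}_{[0,L-1]})\end{bmatrix}\alpha .$$ (ii) Conversely, let $\alpha\in\mathbb{R}^{L-T+1}$ be such that $$\bar{\mathbf{x}}\otimes\bar{\mathbf{u}}_{[0,T-1]}=\mathcal{H}_T(\mathbf{x}\otimes\mathbf{u}_{[0,L-1]})\,\alpha,$$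 where $\bar{\mathbf{x}}_{[0,T-1]}=\mathcal{H}_T(\mathbf{x}_{[0,L-1]})\alpha$ and $\bar{\mathbf{u}}_{[0,T-1]}=\mathcal{H}_T(\mathbf{u}_{[0,L-1]})\alpha$. Then $$\begin{bmatrix}\mathcal{H}_{T+1}(\mathbf{x}_{[0,L]})\\ \mathcal{H}_T(\mathbf{u}_{[0,L-1]})\end{bmatrix}\alpha$$ is (the stacked vector of states at times $0,\dots,T$ and inputs at times $0,\dots,T-1$ of) an input/state trajectory of the system over the time horizon $T$.
   Context: For a sequence $f(0),f(1),\dots$ of vectors in $\mathbb{R}^d$ and $i\le j$, $f_{[i,j]}=[f(i)^\top\ f(i+1)^\top\cdots f(j)^\top]^\top$ is the stacked vector. The notation $\mathbf{x}\otimes\mathbf{u}_{[i,j]}$ denotes the stacked vector of $\mathbf{x}(i)\otimes\mathbf{u}(i),\dots,\mathbf{x}(j)\otimes\mathbf{u}(j)$, where $\otimes$ is the Kronecker product (similarly for $\bar{\mathbf{x}}\otimes\bar{\mathbf{u}}_{[i,j]}$). For a stacked vector $f_{[i,j]}$ and $1\le k\le j-i+1$, the (block) Hankel matrix of depth $k$ is $$\mathcal{H}_k(f_{[i,j]})=\begin{bmatrix} f(i)&f(i+1)&\cdots&f(j-k+1)\\ f(i+1)&f(i+2)&\cdots&f(j-k+2)\\ \vdots&\vdots&&\vdots\\ f(i+k-1)&f(i+k)&\cdots&f(j)\end{bmatrix}\in\mathbb{R}^{dk\times(j-i-k+2)} .$$ An input/state trajectory over the time horizon $T$ is a pair of sequences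 $\bar{\mathbf{u}}(0),\dots,\bar{\mathbf{u}}(T-1)$ and $\bar{\mathbf{x}}(0),\dots,\bar{\mathbf{x}}(T)$ satisfying $\bar{\mathbf{x}}(t+1)=\mathbf{A}\bar{\mathbf{x}}(t)+\mathbf{B}\bar{\mathbf{u}}(t)+\mathbf{N}(\bar{\mathbf{x}}(t)\otimes\bar{\mathbf{u}}(t))$ for $t=0,\dots,T-1$. The data are called $T$-persistently exciting if $$\mathcal{G}_T(L):=\begin{bmatrix}\mathcal{H}_1(\mathbf{x}_{[0,L-T]})\\ \mathcal{H}_T(\mathbf{u}_{[0,L-1]})\\ \mathcal{H}_T(\mathbf{x}\otimes\mathbf{u}_{[0,L-1]})\end{bmatrix}\in\mathbb{R}^{(n+mT+mnT)\times(L-T+1)}$$ has full row rank. *)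

(* Defs.v *)
From HB Require Import structures.
From mathcomp Require Import all_boot all_order all_algebra.
From mathcomp Require Import mxtens reals.

Set Implicit Arguments.
Unset Strict Implicit.
Unset Printing Implicit Defensive.

Import Order.TTheory GRing.Theory Num.Theory.
Local Open Scope ring_scope.

Section Definitions.
Variable R : realType.

(* A sequence of vectors is a total function on nat, of which only the values  *)
(* at the times in question are ever used.                                     *)

(* stack f i l is the stacked vector f_[i, j] with l = j - i + 1 entries.      *)
Definition stack d (f : nat -> 'cV[R]_d) (i l : nat) : 'cV[R]_(\sum_(r < l) d) :=
  \mxcol_(r < l) f (i + r)%N.

(* hankel f i k w is the block Hankel matrix H_k(f_[i, j]) of depth k with     *)
(* w = j - i - k + 2 columns, i.e. j = i + k + w - 2.  The number of columns   *)
(* is the parameter rather than j, so that Hankel matrices of different depths *)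
(* with the same number of columns can be stacked without casts.               *)
Definition hankel d (f : nat -> 'cV[R]_d) (i k w : nat) :
    'M[R]_(\sum_(r < k) d, w) :=
  \mxcol_(r < k) \matrix_(a < d, c < w) f (i + r + c)%N a 0.

(* The type of x *t u is 'M_(n * m, 1 * 1), which is convertible to            *)
(* 'cV_(n * m); the entry x_a * u_b has index a * m + b.                       *)
Definition kron n m (x : 'cV[R]_n) (u : 'cV[R]_m) : 'cV[R]_(n * m) := x *t u.

Definition kron_seq n m (x : nat -> 'cV[R]_n) (u : nat -> 'cV[R]_m) :
    nat -> 'cV[R]_(n * m) :=
  fun t => kron (x t) (u t).

(* The rows of [B AB ... A^(n-1)B] are linearly independent (rank n).          *)
Definition controllable n p (A : 'M[R]_n) (B : 'M[R]_(n, p)) : Prop :=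
  row_free (\mxrow_(k < n) (A ^+ k *m B)).

Definition is_trajectory n m (A : 'M[R]_n) (B : 'M[R]_(n, m))
    (N : 'M[R]_(n, n * m)) (T : nat)
    (u : nat -> 'cV[R]_m) (x : nat -> 'cV[R]_n) : Prop :=
  forall t : nat, (t < T)%N ->
    x t.+1 = A *m x t + B *m u t + N *m kron (x t) (u t).

(* G_T(L), with blocks H_1(x_[0, L-T]), H_T(u_[0, L-1]), H_T((x (x) u)_[0, L-1]). *)
Definition data_matrix n m (x : nat -> 'cV[R]_n) (u : nat -> 'cV[R]_m)
    (T L : nat) :
    'M[R]_(\sum_(r < 1) n + (\sum_(r < T) m + \sum_(r < T) (n * m)),
           L - T + 1) :=
  col_mx (hankel x 0 1 (L - T + 1))
    (col_mx (hankel u 0 T (L - T + 1))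
            (hankel (kron_seq x u) 0 T (L - T + 1))).

Definition persistently_exciting n m (x : nat -> 'cV[R]_n)
    (u : nat -> 'cV[R]_m) (T L : nat) : Prop :=
  row_free (data_matrix x u T L).

End Definitions.

(* Main.v *)
(* For a fixed coefficient vector alpha, multiplying the width-w windows of x,
   u and x (x) u by alpha turns the bilinear recursion of the data into a linear
   recursion for the combined sequences, driven by the combinations of u and of
   x (x) u.  Full row rank lets alpha match the initial state, the inputs and
   the products of a given trajectory, so that the combined states agree with it
   by induction; conversely, the hypothesis on alpha says precisely that the
   combination of the products is the product of the combinations. *)

Require Import Defs.
From HB Require Import structures.
From mathcomp Require Import all_boot all_order all_algebra.
From mathcomp Require Import mxtens reals.

Set Implicit Arguments.
Unset Strict Implicit.
Unset Printing Implicit Defensive.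

Import Order.TTheory GRing.Theory Num.Theory.
Local Open Scope ring_scope.

Section Windows.
Variable R : realType.

(** A block row of a Hankel matrix, indexed by its starting time [t] rather than its position, so
    that the system recursion can relate consecutive block rows. *)
Definition window d (f : nat -> 'cV[R]_d) (w t : nat) : 'M[R]_(d, w) :=
  \matrix_(a, c) f (t + c)%N a 0.

Lemma mul_window d (f : nat -> 'cV[R]_d) p w t (M : 'M[R]_(p, d)) :
  M *m window f w t = window (fun s => M *m f s) w t.
Proof.
by apply/matrixP => a c; rewrite !mxE; apply: eq_bigr => k _; rewrite mxE.
Qed.

(** Block [r] of the Hankel matrix is [window f w (i + r)] by conversion. *)
Lemma hankel_mul d (f : nat -> 'cV[R]_d) i k w (alpha : 'cV[R]_w) :
  hankel f i k w *m alpha = stack (fun t => window f w t *m alpha) i k.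
Proof. exact: mxcol_mul. Qed.

Lemma eq_stackP d (f g : nat -> 'cV[R]_d) i l :
  stack f i l = stack g i l <->
  (forall r, (r < l)%N -> f (i + r)%N = g (i + r)%N).
Proof.
rewrite /stack; split=> [/eq_mxcolP fg r rl | fg]; first exact: (fg (Ordinal rl)).
by apply: eq_mxcol => r; apply: fg.
Qed.

(** The recursion holds column by column: column [c] uses the data at time [t + c], which the bound
    on [t + w] keeps below [L]. *)
Lemma window_trajectory n m (A : 'M[R]_n) (B : 'M[R]_(n, m))
    (N : 'M[R]_(n, n * m)) L (u : nat -> 'cV[R]_m) (x : nat -> 'cV[R]_n) w t :
  is_trajectory A B N L u x -> (t + w <= L)%N ->
  window x w t.+1 =
    A *m window x w t + B *m window u w t + N *m window (kron_seq x u) w t.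
Proof.
move=> hdata htw; rewrite !mul_window; apply/matrixP => a c.
rewrite [LHS]mxE addSn hdata ?(leq_trans _ htw) ?ltn_add2l //.
by rewrite !mxE.
Qed.

End Windows.

Theorem mainTheorem1 (R : realType) (n m : nat)
    (A : 'M[R]_n) (B : 'M[R]_(n, m)) (N : 'M[R]_(n, n * m))
    (hctrl : controllable A (row_mx B N))
    (L T : nat) (hT : (1 <= T)%N) (hTL : (T <= L)%N)
    (x : nat -> 'cV[R]_n) (u : nat -> 'cV[R]_m)
    (hdata : is_trajectory A B N L u x)
    (hpe : persistently_exciting x u T L) :
  (forall (ubar : nat -> 'cV[R]_m) (xbar : nat -> 'cV[R]_n),
     is_trajectory A B N T ubar xbar ->
     exists alpha : 'cV[R]_(L - T + 1),
       col_mx (stack xbar 0 T.+1) (stack ubar 0 T) =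
       col_mx (hankel x 0 T.+1 (L - T + 1)) (hankel u 0 T (L - T + 1))
         *m alpha)
  /\
  (forall (alpha : 'cV[R]_(L - T + 1))
     (ubar : nat -> 'cV[R]_m) (xbar : nat -> 'cV[R]_n),
     stack xbar 0 T = hankel x 0 T (L - T + 1) *m alpha ->
     stack ubar 0 T = hankel u 0 T (L - T + 1) *m alpha ->
     stack (kron_seq xbar ubar) 0 T =
       hankel (kron_seq x u) 0 T (L - T + 1) *m alpha ->
     exists (utraj : nat -> 'cV[R]_m) (xtraj : nat -> 'cV[R]_n),
       is_trajectory A B N T utraj xtraj /\
       col_mx (hankel x 0 T.+1 (L - T + 1)) (hankel u 0 T (L - T + 1))
         *m alpha =
       col_mx (stack xtraj 0 T.+1) (stack utraj 0 T)).
Proof.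
set w := (L - T + 1)%N.
have step t : (t < T)%N -> window x w t.+1 =
    A *m window x w t + B *m window u w t + N *m window (kron_seq x u) w t.
  move=> tT; apply: (window_trajectory hdata).
  (* Here [t + w] equals [t.+1 + (L - T)], and [t.+1 <= T]. *)
  by rewrite /w addn1 addnS -addSn -(subnKC hTL) addKn leq_add2r.
split=> [ubar xbar htraj | alpha ubar xbar].
  pose target := col_mx (stack xbar 0 1)
    (col_mx (stack ubar 0 T) (stack (kron_seq xbar ubar) 0 T)).
  (* Full row rank makes the pseudo-inverse a right inverse. *)
  pose alpha := pinvmx (data_matrix x u T L) *m target.
  have : data_matrix x u T L *m alpha = target.
    by rewrite mulmxA mulmxVp //; apply: mul1mx.
  rewrite /data_matrix !mul_col_mx !hankel_mul.
  move=> /eq_col_mx [/eq_stackP x0 /eq_col_mx [/eq_stackP hu /eq_stackP hxu]].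
  exists alpha; rewrite mul_col_mx !hankel_mul.
  congr col_mx; apply/eq_stackP => t; last by move=> tT; rewrite hu.
  elim: t => [_|t IHt tT]; first by rewrite x0.
  rewrite !add0n in IHt *.
  rewrite htraj // step // !mulmxDl -!mulmxA -IHt 1?ltnW //.
  by rewrite (hu t tT) (hxu t tT).
rewrite !hankel_mul => /eq_stackP hx /eq_stackP hu /eq_stackP hxu.
(* The hypotheses fix [xbar] only at times below [T], so the state at time [T] has to come from the
   combined windows. *)
exists (fun t => window u w t *m alpha), (fun t => window x w t *m alpha).
split; last by rewrite mul_col_mx !hankel_mul.
move=> t tT; rewrite step // !mulmxDl -!mulmxA.
by rewrite -(hx t tT) -(hu t tT) -(hxu t tT).
Qed.
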